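(* Let $f:\mathbb{R}^{n+1}\to\mathbb{R}$ be continuously differentiable, $L$-smooth, and bounded below on $\mathbb{R}^{n+1}$. Suppose $\{x_k\}$ is generated by $x_{k+1}=x_k+\alpha_kd_k$, where the step sizes $\alpha_k$ are obtained by Armijo backtracking with parameters $\sigma\in(0,1)$ and $\beta\in[1/2,1)$, and the directions $d_k$ satisfy $\langle\nabla f(x_k),d_k\rangle<0$ for all $k$. Assume in addition that the directions are T-bounded: in the normal-aligned frame $d_k=\sum_{i=1}^n(\tau_k)_ie_i-e_{n+1}$ and there is a constant $T<\infty$ with $T_k:=\|\tau_k\|\le T$ for all $k$. Then: (i) $f(x_k)$ is strictly decreasing and convergent: $f(x_k)\downarrow f_\infty$ as $k\to\infty$. (ii) $\|\nabla f(x_k)\|\to0$ as $k\to\infty$. (iii) If the sequence $\{x_k\}$ is bounded, then every cluster point of $\{x_k\}$ is a first-order stationary point of $f$.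
   Context: $L$-smooth means $\|\nabla f(x)-\nabla f(y)\|\le L\|x-y\|$ for all $x,y$. Normal-aligned frame at $x_k$ (with $\nabla f(x_k)\ne0$): $e_{n+1}=\nabla f(x_k)/\|\nabla f(x_k)\|$ and $e_1,\dots,e_n$ an orthonormal basis of $\nabla f(x_k)^\perp$ (the frame depends on $k$); $\tau_k\in\mathbb{R}^n$. Armijo backtracking: given $\sigma,\beta\in(0,1)$ and an initial trial step $\alpha_0>0$ (e.g. $\alpha_0=1$), the step is $\beta^m\alpha_0$ for the smallest integer $m\ge0$ such that $f(x_k+\beta^m\alpha_0d_k)\le f(x_k)+\sigma\beta^m\alpha_0\langle\nabla f(x_k),d_k\rangle$. *)

(* Defs.v *)
From HB Require Import structures.
From mathcomp Require Import all_boot all_order all_algebra.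
From mathcomp Require Import all_classical all_reals all_analysis.

Set Implicit Arguments.
Unset Strict Implicit.
Unset Printing Implicit Defensive.

Import Order.TTheory GRing.Theory Num.Theory.
Import numFieldNormedType.Exports.

Local Open Scope classical_set_scope.
Local Open Scope ring_scope.

(* R^d is 'rV[R]_d. The library norm on matrices is the max norm, so the
   Euclidean inner product and norm are defined here; the topology (hence
   differentiability, continuity and cluster points) is the same. *)
Definition dot (R : realType) (d : nat) (u v : 'rV[R]_d) : R :=
  \sum_(i < d) u 0 i * v 0 i.

Definition enorm (R : realType) (d : nat) (u : 'rV[R]_d) : R :=
  Num.sqrt (dot u u).

Definition grad (R : realType) (d : nat) (f : 'rV[R]_d -> R) (x : 'rV[R]_d) :
    'rV[R]_d :=
  \row_(i < d) 'D_(delta_mx 0 i) f x.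

Definition continuously_differentiable (R : realType) (d : nat)
    (f : 'rV[R]_d -> R) : Prop :=
  (forall x, differentiable f x) /\ continuous (grad f).

Definition L_smooth (R : realType) (d : nat) (L : R) (f : 'rV[R]_d -> R) :
    Prop :=
  forall x y, enorm (grad f x - grad f y) <= L * enorm (x - y).

Definition stationary (R : realType) (d : nat) (f : 'rV[R]_d -> R)
    (x : 'rV[R]_d) : Prop :=
  grad f x = 0.

Definition unit_normal (R : realType) (d : nat) (g : 'rV[R]_d) : 'rV[R]_d :=
  (enorm g)^-1 *: g.

(* e_1, ..., e_n is an orthonormal basis of the orthogonal complement of g;
   the last vector of the frame is [unit_normal g]. *)
Definition normal_aligned_frame (R : realType) (n : nat) (g : 'rV[R]_n.+1)
    (e : 'I_n -> 'rV[R]_n.+1) : Prop :=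
  [/\ g != 0,
      forall i j, dot (e i) (e j) = (i == j)%:R
    & forall v, dot v g = 0 <->
        exists c : 'rV[R]_n, v = \sum_(i < n) c 0 i *: e i].

Definition armijo_condition (R : realType) (d : nat) (f : 'rV[R]_d -> R)
    (sigma : R) (x dir : 'rV[R]_d) (a : R) : Prop :=
  f (x + a *: dir) <= f x + sigma * a * dot (grad f x) dir.

Definition armijo_backtracking (R : realType) (d : nat) (f : 'rV[R]_d -> R)
    (sigma beta a0 : R) (x dir : 'rV[R]_d) (a : R) : Prop :=
  exists m : nat,
    [/\ a = beta ^+ m * a0,
        armijo_condition f sigma x dir (beta ^+ m * a0)
      & forall j : nat, (j < m)%N ->
          ~ armijo_condition f sigma x dir (beta ^+ j * a0)].

(* Main.v *)
(* Write [g k] for the gradient norm at [x k]. In the normal-aligned frame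
   [<grad f (x k), d k> = - g k] and [|d k|^2 <= D := T^2 + 1]. L-smoothness
   shows that a step [b] rejected by the Armijo test has
   [b > (1 - sigma) g k / (|L| D)], so [alpha k >= min (a0, C * g k)] with a
   constant [C > 0] and each iteration decreases [f] by at least
   [sigma * min (a0, C * g k) * g k]. As [f (x k)] decreases and is bounded
   below, these decrements tend to 0, hence so does [g k]; continuity of the
   gradient then makes every cluster point stationary. *)

Require Import Defs.
From HB Require Import structures.
From mathcomp Require Import all_boot all_order all_algebra.
From mathcomp Require Import all_classical all_reals all_analysis.
From mathcomp Require Import ring lra.

Set Implicit Arguments.
Unset Strict Implicit.
Unset Printing Implicit Defensive.

Import Order.TTheory GRing.Theory Num.Theory.
Import numFieldNormedType.Exports.

Local Open Scope classical_set_scope.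
Local Open Scope ring_scope.

(** * Euclidean inner product and norm *)

Lemma dotC (R : realType) (d : nat) (u v : 'rV[R]_d) : dot u v = dot v u.
Proof. by apply: eq_bigr => i _; rewrite mulrC. Qed.

Lemma dotDl (R : realType) (d : nat) (u v w : 'rV[R]_d) :
  dot (u + v) w = dot u w + dot v w.
Proof.
by rewrite /dot -big_split; apply: eq_bigr => i _; rewrite mxE mulrDl.
Qed.

Lemma dotZl (R : realType) (d : nat) (a : R) (u w : 'rV[R]_d) :
  dot (a *: u) w = a * dot u w.
Proof. by rewrite /dot mulr_sumr; apply: eq_bigr => i _; rewrite mxE mulrA. Qed.

Lemma dotNl (R : realType) (d : nat) (u w : 'rV[R]_d) :
  dot (- u) w = - dot u w.
Proof. by rewrite -scaleN1r dotZl mulN1r. Qed.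

Lemma dotDr (R : realType) (d : nat) (w u v : 'rV[R]_d) :
  dot w (u + v) = dot w u + dot w v.
Proof. by rewrite dotC dotDl !(dotC _ w). Qed.

Lemma dotZr (R : realType) (d : nat) (a : R) (w u : 'rV[R]_d) :
  dot w (a *: u) = a * dot w u.
Proof. by rewrite dotC dotZl dotC. Qed.

Lemma dotNr (R : realType) (d : nat) (w u : 'rV[R]_d) :
  dot w (- u) = - dot w u.
Proof. by rewrite dotC dotNl dotC. Qed.

Lemma dot_suml (R : realType) (d n : nat) (F : 'I_n -> 'rV[R]_d)
    (w : 'rV[R]_d) :
  dot (\sum_(i < n) F i) w = \sum_(i < n) dot (F i) w.
Proof.
rewrite (big_morph (fun u => dot u w) (id1 := 0) (op1 := +%R)) //.
- by move=> u v; rewrite dotDl.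
- by rewrite -(scale0r 0) dotZl mul0r.
Qed.

Lemma dot_ge0 (R : realType) (d : nat) (u : 'rV[R]_d) : 0 <= dot u u.
Proof. by apply: sumr_ge0 => i _; rewrite -expr2 sqr_ge0. Qed.

Lemma sqr_coord_le_dot (R : realType) (d : nat) (u : 'rV[R]_d) (i : 'I_d) :
  u 0 i ^+ 2 <= dot u u.
Proof.
rewrite /dot (bigD1 i) //= -expr2 lerDl.
by apply: sumr_ge0 => j _; rewrite -expr2 sqr_ge0.
Qed.

Lemma enorm_ge0 (R : realType) (d : nat) (u : 'rV[R]_d) : 0 <= enorm u.
Proof. exact: sqrtr_ge0. Qed.

Lemma enorm_sqr (R : realType) (d : nat) (u : 'rV[R]_d) :
  enorm u ^+ 2 = dot u u.
Proof. by rewrite sqr_sqrtr // dot_ge0. Qed.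

Lemma coord_le_enorm (R : realType) (d : nat) (u : 'rV[R]_d) (i : 'I_d) :
  `|u 0 i| <= enorm u.
Proof. by rewrite -sqrtr_sqr ler_sqrt ?dot_ge0 // sqr_coord_le_dot. Qed.

Lemma enorm_eq0 (R : realType) (d : nat) (u : 'rV[R]_d) :
  enorm u = 0 -> u = 0.
Proof.
move=> u0; apply/rowP => i; rewrite mxE; apply/normr0_eq0/le_anti.
by rewrite normr_ge0 andbT -u0 coord_le_enorm.
Qed.

Lemma enorm_gt0 (R : realType) (d : nat) (u : 'rV[R]_d) :
  u != 0 -> 0 < enorm u.
Proof.
by move=> u0; rewrite lt_neqAle enorm_ge0 andbT eq_sym; apply: contra_neq u0;
  exact: enorm_eq0.
Qed.

Lemma enormZ (R : realType) (d : nat) (a : R) (u : 'rV[R]_d) :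
  enorm (a *: u) = `|a| * enorm u.
Proof.
by rewrite /enorm dotZl dotZr mulrA -expr2 sqrtrM ?sqr_ge0 // sqrtr_sqr.
Qed.

(** Cauchy-Schwarz: for nonzero vectors, with [a] and [b] the norms of [u] and [v], the squared norm
    of [b *: u - a *: v] equals [2 * (a * b) * (a * b - dot u v)] and is nonnegative. *)
Lemma dot_le_enorm (R : realType) (d : nat) (u v : 'rV[R]_d) :
  dot u v <= enorm u * enorm v.
Proof.
have [->|u0] := eqVneq u 0.
  by rewrite -(scale0r 0) dotZl mul0r mulr_ge0 ?enorm_ge0.
have [->|v0] := eqVneq v 0.
  by rewrite -(scale0r 0) dotZr mul0r mulr_ge0 ?enorm_ge0.
have := dot_ge0 (enorm v *: u - enorm u *: v).
rewrite dotDl !dotDr !dotNl !dotNr !dotZl !dotZr -!enorm_sqr (dotC v u).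
move: (enorm_gt0 u0) (enorm_gt0 v0); move: (enorm u) (enorm v) (dot u v).
move=> a b c a0 b0 h; have ab0 : 0 < a * b by exact: mulr_gt0.
rewrite -subr_ge0 -(pmulr_rge0 _ ab0) -(pmulr_rge0 _ (ltr0n R 2)).
by apply: le_trans h _; rewrite le_eqVlt; apply/orP; left; apply/eqP; ring.
Qed.

(** * Derivatives along lines and the quadratic upper bound *)

Lemma derive_dot_grad (R : realType) (d : nat) (f : 'rV[R]_d -> R)
    (x v : 'rV[R]_d) :
  differentiable f x -> 'D_v f x = dot (grad f x) v.
Proof.
move=> df; rewrite deriveE // {1}(row_sum_delta v) linear_sum.
apply: eq_bigr => i _.
by rewrite linearZ /= mxE deriveE // mulrC.
Qed.

Lemma is_derive_line (R : realType) (d : nat) (f : 'rV[R]_d -> R)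
    (x v : 'rV[R]_d) (t : R) :
  differentiable f (x + t *: v) ->
  is_derive t 1 (fun s => f (x + s *: v)) (dot (grad f (x + t *: v)) v).
Proof.
move=> df; rewrite -derive_dot_grad //.
(* The difference quotient of the restriction to the line at [t] is that of [f] at [x + t *: v] in
   direction [v]. *)
have quotE : (fun h : R => h^-1 *: (f (x + (h *: 1 + t) *: v) - f (x + t *: v)))
    = (fun h : R => h^-1 *: (f (h *: v + (x + t *: v)) - f (x + t *: v))).
  by apply/funext => h; rewrite [h *: 1]mulr1 scalerDl addrCA.
have dv : derivable f (x + t *: v) v by exact: diff_derivable.
split; first by rewrite /derivable /= quotE.
by rewrite /derive /= quotE.
Qed.

Lemma mean_value_line (R : realType) (d : nat) (f : 'rV[R]_d -> R)
    (x v : 'rV[R]_d) (a : R) :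
  (forall y, differentiable f y) -> 0 < a ->
  exists2 t, 0 < t < a &
    f (x + a *: v) - f x = a * dot (grad f (x + t *: v)) v.
Proof.
move=> df a0.
have dphi t := is_derive_line (df (x + t *: v)).
have [|t] := MVT a0 (fun t _ => dphi t).
  by apply: derivable_within_continuous => t _; have [] := dphi t.
by rewrite in_itv /= scale0r addr0 subr0 mulrC => ta ->; exists t.
Qed.

(** A descent lemma by the mean value theorem: the slope at the intermediate [t < a] differs from
    the initial slope by at most [|L| * a * dot v v]. Without integration the quadratic constant is
    [|L|] instead of [|L| / 2], which only alters the constant in the step bound. *)
Lemma L_smooth_line_bound (R : realType) (d : nat) (f : 'rV[R]_d -> R) (L : R)
    (x v : 'rV[R]_d) (a : R) :
  (forall y, differentiable f y) -> L_smooth L f -> 0 < a ->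
  f (x + a *: v) <= f x + a * dot (grad f x) v + `|L| * a ^+ 2 * dot v v.
Proof.
move=> df Lf a0; have [t /andP[t0 ta] fE] := mean_value_line x v df a0.
suff key :
    dot (grad f (x + t *: v)) v - dot (grad f x) v <= `|L| * a * dot v v.
  by have := ler_wpM2l (ltW a0) key; lra.
rewrite -dotNl -dotDl; apply: le_trans (dot_le_enorm _ _) _.
have := Lf (x + t *: v) x; rewrite addrAC subrr add0r enormZ gtr0_norm // => Lt.
rewrite -enorm_sqr expr2 mulrA ler_wpM2r ?enorm_ge0 //.
apply: le_trans Lt _; rewrite mulrA ler_wpM2r ?enorm_ge0 //.
(* Passing to [|L|] gives a nonnegative factor, so that [t] can be enlarged to [a]. *)
apply: le_trans (ler_wpM2r (ltW t0) (ler_norm L)) _.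
by rewrite ler_wpM2l // ltW.
Qed.

(** * Directions in the normal-aligned frame, then Armijo steps *)

Lemma frame_tangent_orthogonal (R : realType) (n : nat) (g : 'rV[R]_n.+1)
    (e : 'I_n -> 'rV[R]_n.+1) (c : 'rV[R]_n) :
  normal_aligned_frame g e -> dot (\sum_(i < n) c 0 i *: e i) g = 0.
Proof. by case=> _ _ h; apply/h; exists c. Qed.

Lemma frame_tangent_norm (R : realType) (n : nat) (g : 'rV[R]_n.+1)
    (e : 'I_n -> 'rV[R]_n.+1) (c : 'rV[R]_n) :
  normal_aligned_frame g e ->
  dot (\sum_(i < n) c 0 i *: e i) (\sum_(i < n) c 0 i *: e i) = dot c c.
Proof.
case=> _ on _; rewrite dot_suml; apply: eq_bigr => i _.
rewrite dotZl dotC dot_suml (bigD1 i) //= dotZl on eqxx mulr1.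
rewrite big1 ?addr0 // => j ji.
by rewrite dotZl on (negPf ji) mulr0.
Qed.

Lemma frame_dot_gradient (R : realType) (n : nat) (g : 'rV[R]_n.+1)
    (e : 'I_n -> 'rV[R]_n.+1) (c : 'rV[R]_n) :
  normal_aligned_frame g e ->
  dot g (\sum_(i < n) c 0 i *: e i - unit_normal g) = - enorm g.
Proof.
move=> fr; have [g0 _ _] := fr; have := enorm_gt0 g0 => gn0.
rewrite dotDr dotC (frame_tangent_orthogonal _ fr) dotNr dotZr -enorm_sqr.
by rewrite add0r expr2 mulrA mulVf ?mul1r // gt_eqF.
Qed.

(** Pythagoras: the tangential part has squared norm [enorm c ^+ 2], the normal part is a unit
    vector, and the cross terms vanish. *)
Lemma frame_dot_self (R : realType) (n : nat) (g : 'rV[R]_n.+1)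
    (e : 'I_n -> 'rV[R]_n.+1) (c : 'rV[R]_n) :
  normal_aligned_frame g e ->
  let v := \sum_(i < n) c 0 i *: e i - unit_normal g in
  dot v v = enorm c ^+ 2 + 1.
Proof.
move=> fr /=; have [g0 _ _] := fr; have := enorm_gt0 g0 => gn0.
rewrite dotDl !dotDr !dotNl !dotNr (dotC (unit_normal g) (\sum_(i < n) _)).
rewrite /unit_normal !dotZr dotZl (frame_tangent_orthogonal _ fr).
rewrite (frame_tangent_norm _ fr) -!enorm_sqr mulr0 oppr0 addr0 add0r opprK.
by move: gn0 => /lt0r_neq0 gn0; field.
Qed.

(* With [s = - dot (grad f x) v], a rejected trial step [b] satisfies
   [(1 - sigma) * s < |L| * b * D], and the accepted step is
   [beta] times the last rejected one. *)
Lemma armijo_step_ge (R : realType) (d : nat) (f : 'rV[R]_d -> R)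
    (L sigma beta a0 D : R) (x v : 'rV[R]_d) (a : R) :
  (forall y, differentiable f y) -> L_smooth L f ->
  0 < beta -> 0 < a0 -> 0 < D -> dot v v <= D ->
  armijo_backtracking f sigma beta a0 x v a ->
  Num.min a0 (beta * (1 - sigma) / ((`|L| + 1) * D) * - dot (grad f x) v) <= a.
Proof.
move=> df Lf beta0 a00 D0 vD [[|m] [-> _ rej]].
  (* With no backtracking the step is [a0], the first entry of the minimum. *)
  by rewrite expr0 mul1r ge_min lexx.
have := rej m (ltnSn m); set b := beta ^+ m * a0 => /negP.
have b0 : 0 < b by rewrite mulr_gt0 // exprn_gt0.
rewrite /armijo_condition -ltNge => rejb.
have smo := L_smooth_line_bound x v df Lf b0.
(* The summand 1 keeps the denominator positive even when [L = 0]. *)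
have LD0 : 0 < (`|L| + 1) * D by rewrite mulr_gt0 // ltr_wpDl.
rewrite ge_min; apply/orP; right.
rewrite (_ : beta ^+ m.+1 * a0 = beta * b); last by rewrite /b exprS mulrA.
clearbody b.
rewrite mulrAC ler_pdivrMr // -!mulrA ler_pM2l //.
(* Rejection bounds [f (x + b *: v)] from below and smoothness bounds it from above; comparing the
   two cancels [f x]. *)
have {rejb smo} : b * ((1 - sigma) * - dot (grad f x) v) <
    b * (b * (`|L| * dot v v)) by lra.
rewrite ltr_pM2l // => /ltW /le_trans; apply; rewrite ler_pM2l //.
by apply: ler_pM => //; rewrite ?dot_ge0 // lerDl.
Qed.

Lemma armijo_step_gt0 (R : realType) (d : nat) (f : 'rV[R]_d -> R)
    (sigma beta a0 : R) (x v : 'rV[R]_d) (a : R) :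
  0 < beta -> 0 < a0 -> armijo_backtracking f sigma beta a0 x v a -> 0 < a.
Proof. by move=> b0 a00 [m [-> _ _]]; rewrite mulr_gt0 // exprn_gt0. Qed.

Lemma armijo_decrease (R : realType) (d : nat) (f : 'rV[R]_d -> R)
    (sigma beta a0 : R) (x v : 'rV[R]_d) (a : R) :
  armijo_backtracking f sigma beta a0 x v a ->
  f (x + a *: v) <= f x + sigma * a * dot (grad f x) v.
Proof. by case=> m [-> ? _]. Qed.

(** * Limit arguments and the theorem *)

(** Whenever [g k >= eps], [w k] is at least the fixed positive number [Num.min a (C * eps) * eps],
    which happens for no large [k]. *)
Lemma cvg0_of_min_mul_le (R : realType) (a C : R) (g w : nat -> R) :
  0 < a -> 0 < C -> (forall k, 0 <= g k) ->
  (forall k, Num.min a (C * g k) * g k <= w k) ->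
  w k @[k --> \oo] --> 0 -> g k @[k --> \oo] --> 0.
Proof.
move=> a0 C0 g0 gw /cvgr0Pnorm_lt w0; apply/cvgr0Pnorm_lt => eps eps0.
have m0 : 0 < Num.min a (C * eps) by rewrite lt_min a0 mulr_gt0.
apply: filterS (w0 _ (mulr_gt0 m0 eps0)) => k wk.
rewrite ger0_norm // ltNge; apply/negP => epsg.
have := le_lt_trans (ler_norm _) wk; rewrite ltNge => /negP; apply.
apply: le_trans (gw k); apply: ler_pM => //; rewrite ?(ltW m0) ?(ltW eps0) //.
by rewrite le_min ge_min lexx /= ge_min ler_pM2l // epsg orbT.
Qed.

(** If coordinate [i] of [G p] were nonzero, some term of the sequence near [p] would have this
    coordinate of [G] both within half of [|G p 0 i|] of its value at [p] and smaller than that half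
    in absolute value. *)
Lemma cluster_eq0 (R : realType) (d : nat) (x : nat -> 'rV[R]_d)
    (G : 'rV[R]_d -> 'rV[R]_d) (p : 'rV[R]_d) :
  {for p, continuous G} -> enorm (G (x k)) @[k --> \oo] --> 0 ->
  cluster (x @ \oo) p -> G p = 0.
Proof.
move=> Gp /cvgr0Pnorm_lt Gx xp; apply/rowP => i; rewrite mxE.
apply/eqP; apply/negP => /negP Gpi.
have eps0 : 0 < `|G p 0 i| / 2 by rewrite divr_gt0 // normr_gt0.
have near_p : \forall y \near p, `|G p 0 i - G y 0 i| < `|G p 0 i| / 2.
  have : {for p, continuous (fun y => G y 0 i)}.
    apply: (continuous_comp (f := G) (g := fun v : 'rV[R]_d => v 0 i)) => //.
    exact: coord_continuous.
  by move=> /cvgrPdist_lt/(_ _ eps0).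
have near_x : (x @ \oo) [set y | enorm (G y) < `|G p 0 i| / 2].
  apply: filterS (Gx _ eps0) => k /=.
  by rewrite ger0_norm ?enorm_ge0.
have [y [/= y1 y2]] := xp _ _ near_x near_p.
have := ler_normD (G p 0 i - G y 0 i) (G y 0 i); rewrite subrK.
by have := coord_le_enorm (G y) i; lra.
Qed.

Theorem theorem7p5 (R : realType) (n : nat) (f : 'rV[R]_n.+1 -> R) (L : R)
    (sigma beta a0 T : R)
    (x d : nat -> 'rV[R]_n.+1) (alpha : nat -> R)
    (e : nat -> 'I_n -> 'rV[R]_n.+1) (tau : nat -> 'rV[R]_n)
    (f_C1 : continuously_differentiable f)
    (f_smooth : L_smooth L f)
    (f_bounded_below : exists m : R, forall y, m <= f y)
    (sigma_gt0 : 0 < sigma) (sigma_lt1 : sigma < 1)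
    (beta_ge_half : 2^-1 <= beta) (beta_lt1 : beta < 1)
    (a0_gt0 : 0 < a0)
    (x_step : forall k, x k.+1 = x k + alpha k *: d k)
    (alpha_armijo :
      forall k, armijo_backtracking f sigma beta a0 (x k) (d k) (alpha k))
    (d_descent : forall k, dot (grad f (x k)) (d k) < 0)
    (frame : forall k, normal_aligned_frame (grad f (x k)) (e k))
    (d_frame : forall k,
      d k = \sum_(i < n) tau k 0 i *: e k i - unit_normal (grad f (x k)))
    (tau_bounded : forall k, enorm (tau k) <= T) :
  [/\ decreasing_seq (fun k => f (x k)) /\
        (exists f_inf : R, f (x k) @[k --> \oo] --> f_inf),
      enorm (grad f (x k)) @[k --> \oo] --> (0 : R)
    & (exists M : R, forall k, enorm (x k) <= M) ->
        forall p : 'rV[R]_n.+1, cluster (x @ \oo) p -> stationary f p].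

Proof.
have [df gradC] := f_C1.
have beta_gt0 : 0 < beta by apply: lt_le_trans beta_ge_half; rewrite invr_gt0.
have alpha_gt0 k := armijo_step_gt0 beta_gt0 a0_gt0 (alpha_armijo k).
have gd k : dot (grad f (x k)) (d k) = - enorm (grad f (x k)).
  by rewrite d_frame (frame_dot_gradient _ (frame k)).
have f_decr k : f (x k.+1) <= f (x k) - sigma * alpha k * enorm (grad f (x k)).
  by rewrite x_step -mulrN -gd; exact: armijo_decrease (alpha_armijo k).
have f_decreasing : decreasing_seq (fun k => f (x k)).
  apply/decreasing_seqP => k; apply: le_lt_trans (f_decr k) _.
  rewrite gtrDl oppr_lt0 !mulr_gt0 //.
  by have [g0 _ _] := frame k; exact: enorm_gt0.
have f_cvg : cvgn (fun k => f (x k)).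
  apply: nonincreasing_is_cvgn.
    (* [decreasing_seq] is an equivalence of orders, which makes the decrease strict; rewriting with
       it leaves [i <= j]. *)
    by move=> i j ij; rewrite (f_decreasing i j).
  by have [m fm] := f_bounded_below; exists m => _ [k _ <-].
have g_cvg0 : enorm (grad f (x k)) @[k --> \oo] --> (0 : R).
  pose D := T ^+ 2 + 1.
  have D_gt0 : 0 < D by rewrite ltr_wpDl ?sqr_ge0.
  have dD k : dot (d k) (d k) <= D.
    rewrite d_frame (frame_dot_self _ (frame k)) lerD2r lerXn2r ?nnegrE //.
      exact: enorm_ge0.
    (* Nonnegativity of [T], needed for squaring, comes from the bound on [tau k]. *)
    exact: le_trans (enorm_ge0 _) (tau_bounded k).
  pose C := beta * (1 - sigma) / ((`|L| + 1) * D).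
  have C_gt0 : 0 < C.
    by rewrite divr_gt0 ?mulr_gt0 ?subr_gt0 // ltr_wpDl.
  (* The decrease of [f] rescaled so that it dominates [alpha k * enorm (grad f (x k))]. *)
  pose w k := sigma^-1 * (f (x k) - f (x k.+1)).
  apply: (@cvg0_of_min_mul_le _ a0 C _ w) => // [k|k|].
  - exact: enorm_ge0.
  - have step := armijo_step_ge df f_smooth beta_gt0 a0_gt0 D_gt0 (dD k)
      (alpha_armijo k).
    rewrite gd opprK -/C in step.
    apply: le_trans (ler_wpM2r (enorm_ge0 _) step) _.
    rewrite /w ler_pdivlMl //.
    by have := f_decr k; lra.
  (* The sequence of values and its shift have the same limit, so [w] tends to 0. *)
  - rewrite -(mulr0 sigma^-1) -(subrr (limn (fun k => f (x k)))).
    apply: cvgMr; apply: cvgB => //.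
    by rewrite (cvg_shiftS (fun k => f (x k))).
split.
- by split => //; exists (limn (fun k => f (x k))).
- exact: g_cvg0.
- by move=> _ p; exact: cluster_eq0 (gradC p) g_cvg0.
Qed.
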